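(* Let $\alpha,\delta>0$ and let $c=\alpha n$. Then there exists a constant $d=d(\delta)$, depending only on $\delta$, such that with high probability $G_c\left(n,\frac{d}{n}\right)$ contains a rainbow cycle of length at least $(1-\delta)\min\{n,c\}$.
   Context: For $c,n\in\mathbb{N}$ and $p\in(0,1)$, $G_c(n,p)$ is the random edge-coloured graph obtained by taking the Erdős–Rényi binomial random graph $G(n,p)$ on $n$ vertices and assigning to each edge a colour chosen independently and uniformly at random from a set of $c$ colours. A subgraph is rainbow if all of its edges receive different colours. ''With high probability'' means with probability tending to $1$ as $n\to\infty$. Floors and ceilings are ignored where they do not significantly affect the argument (so $c=\alpha n$ is understood up to rounding to an integer). *)

(* Defs.v *)
From mathcomp Require Import all_boot all_order all_algebra.
From mathcomp Require Import all_classical all_reals all_analysis.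
Set Implicit Arguments.
Unset Strict Implicit.
Unset Printing Implicit Defensive.
Import Order.TTheory GRing.Theory Num.Theory.
Import numFieldNormedType.Exports.
Local Open Scope ring_scope.

Notation vpair n := {e : {set 'I_n} | #|e| == 2%N}.

(* [None] means that the pair is not an edge; [Some k] that it is an edge of
   colour [k]. *)
Notation coloured_graph n c := {ffun vpair n -> option 'I_c}.

Definition edge_set (n c : nat) (g : coloured_graph n c) : {set vpair n} :=
  [set e | isSome (g e)].

Definition adjacent (n c : nat) (g : coloured_graph n c) : rel 'I_n :=
  fun x y => [exists e in edge_set g, val e == [set x; y]].

Definition cycle_edges (n : nat) (s : seq 'I_n) : {set vpair n} :=
  [set e | [exists x in s, val e == [set x; next s x]]].

Definition rainbow (n c : nat) (g : coloured_graph n c) (H : {set vpair n}) :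
    Prop :=
  {in H &, injective g}.

(* The cycle is given by the cyclic list of its distinct vertices. *)
Definition is_cycle (n c : nat) (g : coloured_graph n c) (s : seq 'I_n) :
    Prop :=
  (3 <= size s)%N /\ ucycle (adjacent g) s.

Definition has_rainbow_cycle_of_length_ge (R : realType) (n c : nat)
    (g : coloured_graph n c) (l : R) : Prop :=
  exists s : seq 'I_n,
    [/\ is_cycle g s, rainbow g (cycle_edges s) & l <= (size s)%:R].

(* The law of the binomial random graph G(n, p). *)
Definition Gnp (R : realType) (n : nat) (p : R) (E : {set vpair n}) : R :=
  \prod_(e : vpair n) (if e \in E then p else 1 - p).

(* The law of G_c(n, p): given its edge set E, each of the c ^ #|E| colourings
   of E is equally likely.  It has total mass 1 when 0 < c (Gcnp_sum1), and is
   a probability distribution when moreover 0 <= p <= 1. *)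
Definition Gcnp (R : realType) (n c : nat) (p : R) (g : coloured_graph n c) :
    R :=
  Gnp p (edge_set g) * (c%:R^-1) ^+ #|edge_set g|.

Definition Gcnp_prob (R : realType) (n c : nat) (p : R)
    (A : set (coloured_graph n c)) : R :=
  \sum_(g : coloured_graph n c | g \in A) Gcnp p g.

Lemma Gcnp_sum1 (R : realType) (n c : nat) (p : R) :
  (0 < c)%N -> \sum_(g : coloured_graph n c) Gcnp p g = 1.
Proof.
move=> c0.
pose F (_ : vpair n) (o : option 'I_c) : R :=
  if isSome o then p * c%:R^-1 else 1 - p.
transitivity (\sum_(g : coloured_graph n c) \prod_e F e (g e)).
  apply: eq_bigr => g _; rewrite /Gcnp /Gnp -prodr_const.
  rewrite (big_mkcond (mem (edge_set g))) -big_split; apply: eq_bigr => e _.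
  by rewrite /F /= inE; case: (g e) => //=; rewrite mulr1.
rewrite -(bigA_distr_bigA F) big1 // => e _.
rewrite (bigD1 None) //= /F /= (reindex_omap Some id) /=; last by case.
rewrite (eq_bigl predT) => [|i]; last by rewrite eqxx.
rewrite sumr_const card_ord -[X in _ + X]mulr_natr -mulrA.
by rewrite mulVf ?pnatr_eq0 -?lt0n // mulr1 subrK.
Qed.

(* Main.v *)
Require Import Defs.
From mathcomp Require Import all_boot all_order all_algebra.
From mathcomp Require Import all_classical all_reals all_analysis.
From mathcomp Require Import zify lra ring.
Set Implicit Arguments.
Unset Strict Implicit.
Unset Printing Implicit Defensive.
Import Order.TTheory GRing.Theory Num.Theory.
Import numFieldNormedType.Exports.
Local Open Scope ring_scope.

(** A rainbow path is grown by depth-first search, looking at the coloured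
    random graph one pair of vertices at a time.  The search keeps a rainbow
    path whose top vertex [v] is the active one, and asks for a pair [{v, u}]
    with [u] unvisited that was never looked at before.  If the pair turns out
    to be an edge whose colour does not occur on the path, then [u] is pushed;
    when [v] has no pair left to ask about, it is popped for good.  As long as
    the path has at most (1 - delta/2) min(n, c) colours, at least a fraction
    delta/2 of all colours is free, so every question succeeds with probability
    at least q = (d/n)(delta/2), whatever happened before.  No union bound over
    sets of colours is taken, and this is why [d] does not depend on [alpha].

    Every pair between a finished vertex and an unvisited one has been looked
    at.  So when the number of unvisited vertices has dropped to about
    delta n/16 while the path has stayed short, the number of questions is
    quadratic in [n] ([card_revealed]), although there were at most [n]
    successes, one for each visited vertex.  For large [d] this is
    exponentially unlikely: 2^#|unvisited| (1 - q/2)^(number of questions still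
    to be asked) is a supermartingale ([condP_search]).

    To close the path into a cycle, the vertices are split into two halves [X]
    and [~: X] and the search only asks about pairs between the halves.  The
    path then alternates between them, and the pairs inside [X] are still
    untouched.  There are K^2 of them, with K linear in [n], that join one of
    the first 2K vertices of the path to one of the last 2K, and each of them
    has a free colour with probability at least [q]; all fail with probability
    at most (1 - q)^(K^2) ([condP_close]).  Such an edge closes a rainbow cycle
    that misses fewer than 4K vertices of the path.

    Independence enters only through [condP_step]: revealing a fresh pair
    averages the conditional probability over the law of its colour. *)

(** * Rainbow cycles as cyclic lists of darts *)

Lemma pair_of (n : nat) (x y : 'I_n) :
  x != y -> exists e : vpair n, val e = [set x; y]%SET.
Proof.
move=> xy; have h : #|[set x; y]%SET| == 2%N by rewrite cards2 xy.
by exists (exist (fun e : {set _} => #|e| == 2%N) _ h).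
Qed.

Lemma next_map_uniq (S T : eqType) (f : S -> T) (s : seq S) (x : S) :
  uniq (map f s) -> x \in s -> next (map f s) (f x) = f (next s x).
Proof.
move=> Uf sx; have [i s' E] := rot_to sx.
rewrite -(next_rot i Uf) -(next_rot i (map_uniq Uf)) -map_rot E.
by case: s' {E} => [|y s'] /=; rewrite !eqxx.
Qed.

Lemma uniq_map_inj (S T : eqType) (f : S -> T) (s : seq S) :
  uniq (map f s) -> {in s &, injective f}.
Proof.
elim: s => //= z s IH /andP[/mapP zs /IH inj] x y; rewrite !inE.
move=> /predU1P[->|xs] /predU1P[->|ys] // E; last exact: inj.
  by case: zs; exists y.
by case: zs; exists x.
Qed.

(** A path or cycle is encoded as a list of coloured vertices, where each vertex
    carries the colour of the edge that leads to the next entry.  Only the pairs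
    in [Q] are consulted, so that the relation is determined by what is known of
    [g] on [Q]. *)
Definition dart (n c : nat) (Q : {set vpair n}) (g : coloured_graph n c) :
    rel ('I_c * 'I_n) :=
  fun b a => [exists e in Q, (val e == [set b.2; a.2]%SET) && (g e == Some b.1)].

Lemma dartP (n c : nat) (Q : {set vpair n}) (g : coloured_graph n c)
    (b a : 'I_c * 'I_n) :
  reflect (exists e, [/\ e \in Q, val e = [set b.2; a.2]%SET & g e = Some b.1])
    (dart Q g b a).
Proof.
apply: (iffP existsP) => -[e].
  by case/and3P=> eQ /eqP ve /eqP ge; exists e.
by case=> eQ ve ge; exists e; rewrite eQ ve ge !eqxx.
Qed.

Lemma dart_sub (n c : nat) (Q Q' : {set vpair n}) (g g' : coloured_graph n c) :
  Q \subset Q' -> {in Q, g =1 g'} -> subrel (dart Q g) (dart Q' g').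
Proof.
move=> sQ gg' b a /dartP[e [eQ ve ge]]; apply/dartP.
by exists e; split=> //; [exact: (fintype.subsetP sQ) | rewrite -gg'].
Qed.

(** Distinct edges of the cycle leave distinct vertices, and the colours that
    these vertices carry are distinct. *)
Lemma dart_cycle_rainbow (n c : nat) (g : coloured_graph n c)
    (s : seq ('I_c * 'I_n)) :
  (3 <= size s)%N -> uniq (map fst s) -> uniq (map snd s) ->
  cycle (dart finset.setT g) s ->
  is_cycle g (map snd s) /\ rainbow g (cycle_edges (map snd s)).
Proof.
move=> s3 U1 U2 Cs; split.
  split; first by rewrite size_map.
  apply/andP; split=> //; rewrite cycle_map.
  apply: sub_cycle Cs => b a /dartP[e [_ ve ge]].
  by apply/existsP; exists e; rewrite inE ge ve eqxx.
have cyc e : e \in cycle_edges (map snd s) ->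
    exists2 b, b \in s & val e = [set b.2; (next s b).2]%SET /\ g e = Some b.1.
  rewrite inE => /existsP[x /andP[/mapP[b bs ->] /eqP ve]]; exists b => //.
  have /dartP[e' [_ ve' ge']] := next_cycle Cs bs.
  rewrite next_map_uniq // in ve; split=> //.
  by have -> : e = e' by apply: val_inj; rewrite /= ve ve'.
move=> e e' /cyc[b bs [ve ge]] /cyc[b' bs' [ve' ge']]; rewrite ge ge' => -[bb'].
apply: val_inj => /=; rewrite ve ve'.
suff -> : b = b' by [].
exact: (uniq_map_inj U1).
Qed.

(** * Pairs between two sets, and alternating lists *)

Definition pairs (n : nat) (A B : {set 'I_n}) : {set vpair n} :=
  [set e | [exists x in A, exists y in B, val e == [set x; y]%SET]].

Lemma pairsP (n : nat) (A B : {set 'I_n}) (e : vpair n) :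
  reflect (exists x y, [/\ x \in A, y \in B & val e = [set x; y]%SET])
    (e \in pairs A B).
Proof.
rewrite inE; apply: (iffP existsP).
  case=> x /andP[xA /existsP[y /andP[yB /eqP ve]]]; by exists x, y.
case=> x [y [xA yB ve]]; exists x; rewrite xA; apply/existsP; exists y.
by rewrite yB ve eqxx.
Qed.

Lemma set2_eq_cross (T : finType) (A B : {set T}) (x y x' y' : T) :
  [disjoint A & B] -> x \in A -> x' \in A -> y \in B -> y' \in B ->
  [set x; y] = [set x'; y'] -> (x, y) = (x', y').
Proof.
move=> dAB xA xA' yB yB' E.
have ne u v : u \in A -> v \in B -> (u == v) = false.
  move=> uA vB; apply/eqP => uv.
  by move/pred0P: dAB => /(_ v); rewrite /= -{1}uv uA vB.
have : x \in [set x'; y'] by rewrite -E set21.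
have : y \in [set x'; y'] by rewrite -E set22.
rewrite !inE (ne x y') // [y == x']eq_sym (ne x' y) //= orbF.
by move=> /eqP-> /eqP->.
Qed.

(** Counts the closing pairs as well as the pairs that a long search must have
    revealed. *)
Lemma card_pairs (n : nat) (A B : {set 'I_n}) :
  [disjoint A & B] -> #|pairs A B| = (#|A| * #|B|)%N.
Proof.
move=> dAB.
rewrite -(card_imset _ val_inj) -cardsX.
rewrite -(@card_in_imset _ _ (fun u => [set u.1; u.2]%SET) (finset.setX A B)).
  apply: eq_card => u; apply/imsetP/imsetP.
    case=> e /pairsP[x [y [xA yB ve]]] ->; exists (x, y) => //.
    by rewrite inE xA yB.
  case=> -[x y]; rewrite inE /= => /andP[xA yB] ->.
  have xy : x != y.
    by apply: contraTneq xA => ->; rewrite (disjointFl dAB).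
  have [e ve] := pair_of xy.
  by exists e; rewrite ?ve //; apply/pairsP; exists x, y.
move=> [x y] [x' y']; rewrite !inE /= => /andP[xA yB] /andP[xA' yB'].
exact: (set2_eq_cross dAB).
Qed.

Definition alternating (T : finType) (X : {set T}) (s : seq T) : bool :=
  sorted (fun x y => (x \in X) != (y \in X)) s.

(** The two halves of the vertex set share the vertices of an alternating path
    evenly, up to one. *)
Lemma count_alternating (T : finType) (X : {set T}) (s : seq T) :
  alternating X s ->
  ((size s)./2 <= count (fun x => x \in X) s <= uphalf (size s))%N.
Proof.
case: s => //= x s; rewrite /alternating /= => alt.
suff: (count (fun x => x \in X) s =
  if x \in X then (size s)./2 else uphalf (size s)) by case: ifP => _ ->; lia.
elim: s x alt => [|y s IH] x /=; first by case: ifP.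
case/andP=> xy /IH ->; move: xy.
by case: (x \in X); case: (y \in X) => //=; lia.
Qed.

(** * Revealing the coloured random graph pair by pair *)

Definition colour_law (R : realType) (c : nat) (p : R) (o : option 'I_c) : R :=
  if isSome o then p / c%:R else 1 - p.

Lemma sum_colour_law (R : realType) (c : nat) (p : R) (C : {set 'I_c}) (u v : R) :
  (0 < c)%N ->
  \sum_o colour_law p o * (if o is Some k then if k \in C then v else u else u)
  = u - p * #|C|%:R / c%:R * (u - v).
Proof.
move=> c0; have c1 : c%:R != 0 :> R by rewrite pnatr_eq0 -lt0n.
rewrite (bigD1 None) //= /colour_law /= (reindex_omap Some id) /=; last by case.
rewrite (eq_bigl predT) => [|i]; last by rewrite eqxx.
rewrite -mulr_sumr (bigID (mem C)) /=.
rewrite (eq_bigr (fun=> v)); last by move=> i ->.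
rewrite [X in _ + (_ * (_ + X))](eq_bigr (fun=> u)); last by move=> i /negPf ->.
rewrite !sumr_const.
have E : #|C|%:R + #|[predC C]|%:R = c%:R :> R by rewrite -natrD cardC card_ord.
rewrite -[v *+ _]mulr_natl -[u *+ _]mulr_natl.
have -> : #|[predC C]|%:R = c%:R - #|C|%:R :> R by rewrite -E addrC addKr.
by field.
Qed.

Lemma colour_law_ge0 (R : realType) (c : nat) (p : R) (o : option 'I_c) :
  0 <= p <= 1 -> 0 <= colour_law p o.
Proof.
case/andP=> p0 p1; rewrite /colour_law; case: ifP => _; last by rewrite subr_ge0.
by rewrite divr_ge0 ?ler0n.
Qed.

Lemma colour_law_sum1 (R : realType) (c : nat) (p : R) :
  (0 < c)%N -> \sum_(o : option 'I_c) colour_law p o = 1.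
Proof.
move=> c0; have := @sum_colour_law R c p finset.set0 1 1 c0.
rewrite subrr mulr0 subr0 => <-; apply: eq_bigr => o _.
by case: o => [k|]; rewrite ?inE mulr1.
Qed.

(** One question of the search: a free colour (in [C]) shows up with probability
    at least [q], and then the bound improves from [u] to [v]. *)
Lemma colour_law_mean_le (R : realType) (c : nat) (p q : R) (C : {set 'I_c})
    (f : option 'I_c -> R) (u v : R) :
  (0 < c)%N -> 0 <= p <= 1 -> q <= p * #|C|%:R / c%:R -> v <= u ->
  (forall o, f o <= u) -> (forall k, k \in C -> f (Some k) <= v) ->
  \sum_o colour_law p o * f o <= u - q * (u - v).
Proof.
move=> c0 p01 qC vu fu fv.
apply: (@le_trans _ _ (u - p * #|C|%:R / c%:R * (u - v))); last first.
  by rewrite lerB // ler_wpM2r ?subr_ge0.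
rewrite -sum_colour_law //; apply: ler_sum => o _.
apply: ler_wpM2l; first exact: colour_law_ge0.
by case: o => [k|] //; case: ifP => // /fv.
Qed.

(** The pairs are independent, each with law [colour_law]. *)
Lemma Gcnp_prodE (R : realType) (n c : nat) (p : R) (g : coloured_graph n c) :
  Gcnp p g = \prod_e colour_law p (g e).
Proof.
rewrite /Gcnp /Gnp -prodr_const.
rewrite (big_mkcond (mem (edge_set g))) -big_split; apply: eq_bigr => e _.
by rewrite /colour_law /= inE; case: (g e) => //=; rewrite mulr1.
Qed.

Lemma Gcnp_ge0 (R : realType) (n c : nat) (p : R) (g : coloured_graph n c) :
  0 <= p <= 1 -> 0 <= Gcnp p g.
Proof.
by move=> p01; rewrite Gcnp_prodE prodr_ge0 // => e _; apply: colour_law_ge0.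
Qed.

Definition recolour (n c : nat) (g : coloured_graph n c) (e : vpair n)
    (o : option 'I_c) : coloured_graph n c :=
  [ffun e' => if e' == e then o else g e'].

Definition override (n c : nat) (Q : {set vpair n}) (h g : coloured_graph n c) :
    coloured_graph n c :=
  [ffun e => if e \in Q then h e else g e].

(** By independence, the conditional probability of [A] given that the graph
    agrees with [h] on [Q] is obtained by overwriting a fresh sample on [Q].
    Unlike a quotient, this makes sense even if the condition has probability
    zero. *)
Definition condP (R : realType) (n c : nat) (p : R) (Q : {set vpair n})
    (h : coloured_graph n c) (A : pred (coloured_graph n c)) : R :=
  \sum_g Gcnp p g * (A (override Q h g))%:R.

Lemma condP_le1 (R : realType) (n c : nat) (p : R) (Q : {set vpair n})
    (h : coloured_graph n c) (A : pred (coloured_graph n c)) :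
  (0 < c)%N -> 0 <= p <= 1 -> condP p Q h A <= 1.
Proof.
move=> c0 p01; rewrite -(Gcnp_sum1 n p c0); apply: ler_sum => g _.
by rewrite ler_piMr ?Gcnp_ge0 // lern1 leq_b1.
Qed.

Lemma condP_eq0 (R : realType) (n c : nat) (p : R) (Q : {set vpair n})
    (h : coloured_graph n c) (A : pred (coloured_graph n c)) :
  (forall g : coloured_graph n c, {in Q, g =1 h} -> ~~ A g) -> condP p Q h A = 0.
Proof.
move=> nA; rewrite /condP big1 // => g _.
by rewrite (negbTE (nA _ _)) ?mulr0 // => e eQ; rewrite ffunE eQ.
Qed.

(** The law of total probability for the colour of [e].  The proof draws a second
    independent colour [o] and exchanges it with that of [e]: this preserves the
    joint law, and turns the graph with [e] left random into the graph with [e]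
    fixed to [o]. *)
Lemma condP_step (R : realType) (n c : nat) (p : R) (Q : {set vpair n})
    (h : coloured_graph n c) (A : pred (coloured_graph n c)) (e : vpair n) :
  (0 < c)%N -> e \notin Q ->
  condP p Q h A =
  \sum_o colour_law p o * condP p (e |: Q) (recolour h e o) A.
Proof.
move=> c0 eQ; rewrite /condP.
under [RHS]eq_bigr do rewrite mulr_sumr.
rewrite pair_big /=.
pose swap (u : option 'I_c * coloured_graph n c) := (u.2 e, recolour u.2 e u.1).
have swapK : involutive swap.
  case=> o g; rewrite /swap /= ffunE eqxx; congr (_, _).
  by apply/ffunP => e'; rewrite !ffunE; case: eqP => // ->.
rewrite (reindex_inj (inv_inj swapK)) /=.
transitivity (\sum_(u : option 'I_c * coloured_graph n c)
    colour_law p u.1 * (Gcnp p u.2 * (A (override Q h u.2))%:R)).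
  (* The colour [u.1] is now integrated out. *)
  rewrite -(pair_bigA _ (fun o g => colour_law p o *
    (Gcnp p g * (A (override Q h g))%:R))) /= exchange_big /=.
  by apply: eq_bigr => g _; rewrite -mulr_suml colour_law_sum1 // mul1r.
apply: eq_bigr; case=> o g _ /=; rewrite !Gcnp_prodE !mulrA; congr (_ * _).
  rewrite (bigD1 e) //= [in RHS](bigD1 e) //= ffunE eqxx.
  rewrite mulrCA; congr (_ * (_ * _)); apply: eq_bigr => e' /negbTE ne.
  by rewrite ffunE ne.
congr (_ %:R); congr (nat_of_bool (A _)); apply/ffunP => e'; rewrite !ffunE !inE.
by case: eqP => [->|] //=; rewrite (negbTE eQ).
Qed.

(** If a single edge of [F] with colour in [C] prevents [A], then all pairs of
    [F] have to fail independently. *)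
Lemma condP_avoid (R : realType) (n c : nat) (p q : R) (Q F : {set vpair n})
    (h : coloured_graph n c) (A : pred (coloured_graph n c)) (C : {set 'I_c}) :
  (0 < c)%N -> 0 <= p <= 1 -> q <= p * #|C|%:R / c%:R ->
  [disjoint F & Q] ->
  (forall (g : coloured_graph n c) e k, {in Q, g =1 h} ->
     e \in F -> k \in C -> g e = Some k -> ~~ A g) ->
  condP p Q h A <= (1 - q) ^+ #|F|.
Proof.
move=> c0 p01 qC; have q1 : 0 <= 1 - q.
  rewrite subr_ge0 (le_trans qC) // -mulrA.
  case/andP: (p01) => p0 p1; rewrite mulr_ile1 ?divr_ge0 ?ler0n //.
  by rewrite ler_pdivrMr ?ltr0n // mul1r ler_nat -[leqRHS]card_ord max_card.
have [m] := ubnP #|F|; elim: m F Q h => // m IH F Q h Fm dFQ nA.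
have [->|[e eF]] := set_0Vmem F.
  by rewrite cards0 expr0 condP_le1.
have eQ : e \notin Q by rewrite (disjointFr dFQ).
rewrite (condP_step p h A c0 eQ) (cardsD1 e) eF exprS.
apply: (le_trans (@colour_law_mean_le _ _ p q C _ ((1 - q) ^+ #|F :\ e|) 0
  c0 p01 qC _ _ _)); last by rewrite subr0 mulrBl mul1r.
- by rewrite exprn_ge0.
- move=> o; apply: IH.
  + by move: Fm; rewrite (cardsD1 e) eF ltnS.
  + rewrite -setI_eq0; apply/eqP/setP => x; rewrite !inE.
    have [//|_ /=] := eqVneq x e.
    by case: (boolP (x \in F)) => // xF; rewrite (disjointFr dFQ).
  + move=> g e' k gh /setD1P[_ e'F]; apply: nA => // x xQ.
    rewrite gh ?inE ?xQ ?orbT // ffunE ifN //.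
    by apply: contraNneq eQ => <-.
- move=> k kC; rewrite condP_eq0 // => g gh.
  apply: (nA g e k) => //; last by rewrite gh ?setU11 // ffunE eqxx.
  move=> x xQ; rewrite gh ?inE ?xQ ?orbT // ffunE ifN //.
  by apply: contraNneq eQ => <-.
Qed.

(** * Closing a long path into a cycle *)

(** The last vertex [y] of a segment trades its colour for that of the closing
    edge; this keeps the other darts intact because a dart does not depend on the
    colour carried by its second vertex. *)
Lemma close_cycle (n c : nat) (g : coloured_graph n c)
    (p1 m p2 : seq ('I_c * 'I_n)) (x y : 'I_c * 'I_n) (k : 'I_c) (e : vpair n) :
  let p := p1 ++ (rcons (x :: m) y ++ p2) in
  let s := map snd (rcons (x :: m) (k, y.2)) in
  sorted (dart finset.setT g) p -> uniq (map fst p) -> uniq (map snd p) ->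
  (0 < size m)%N -> k \notin map fst p ->
  val e = [set x.2; y.2]%SET -> g e = Some k ->
  is_cycle g s /\ rainbow g (cycle_edges s).
Proof.
move=> p s sp U1 U2 m0 kp ve ge.
have [_ /cat_sorted2[sxy _]] := cat_sorted2 sp.
apply: dart_cycle_rainbow.
- by rewrite size_rcons /= !ltnS.
- rewrite map_rcons rcons_uniq; apply/andP; split.
    apply: contra kp => /= km.
    by rewrite !map_cat !mem_cat map_rcons mem_rcons in_cons km !orbT.
  move: U1; rewrite !map_cat cat_uniq => /and3P[_ _].
  by rewrite cat_uniq map_rcons rcons_uniq => /andP[/andP[]].
- have -> : map snd (rcons (x :: m) (k, y.2)) = map snd (rcons (x :: m) y).
    by rewrite !map_rcons.
  move: U2; rewrite !map_cat cat_uniq => /and3P[_ _].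
  by rewrite cat_uniq => /andP[].
- rewrite (cycle_path x) last_rcons /=; apply/andP; split.
    by apply/dartP; exists e; rewrite inE ve finset.setUC.
  by move: sxy; rewrite /= !rcons_path.
Qed.

Lemma card_set_count (T : finType) (X : {set T}) (s : seq T) :
  uniq s -> #|[set x in s] :&: X| = count (fun x => x \in X) s.
Proof.
move=> Us; rewrite -size_filter -(card_uniqP (filter_uniq _ Us)).
by apply: eq_card => x; rewrite !inE mem_filter andbC.
Qed.

Lemma alternating_setC (T : finType) (X : {set T}) (s : seq T) :
  alternating X s -> alternating (~: X) s.
Proof.
apply: sub_sorted => x y; rewrite !inE.
by case: (x \in X); case: (y \in X).
Qed.

(** The pairs joining, inside [X], the first [2 * K] to the last [2 * K] vertices
    of the path are fresh, since only pairs across [X] and [~: X] are revealed.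
    An alternating list of [2 * K] vertices has [K] of them in [X], so there are
    [K ^ 2] such pairs, and a closing one loses at most [2 * K - 1] vertices at
    each end. *)
Lemma condP_close (R : realType) (n c L K : nat) (p q : R) (X : {set 'I_n})
    (Q : {set vpair n}) (h : coloured_graph n c)
    (A : pred (coloured_graph n c)) (s : seq ('I_c * 'I_n)) :
  (0 < c)%N -> 0 <= p <= 1 ->
  (forall C : {set 'I_c}, (c <= #|C| + L)%N -> q <= p * #|C|%:R / c%:R) ->
  (4 * K < L)%N ->
  (forall g s, is_cycle g s -> rainbow g (cycle_edges s) ->
     (L - 4 * K + 2 <= size s)%N -> ~~ A g) ->
  size s = L -> uniq (map fst s) -> uniq (map snd s) -> sorted (dart Q h) s ->
  alternating X (map snd s) -> Q \subset pairs X (~: X) ->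
  condP p Q h A <= (1 - q) ^+ (K ^ 2).
Proof.
move=> c0 p01 hq KL hA sL U1 U2 path_s alt QX.
have [K1 K2 K3] : [/\ (K.*2 <= L - K.*2)%N, (K.*2 <= L)%N &
    (L - K.*2 - K.*2 = L - 4 * K)%N].
  by clear -KL; split; lia.
pose first := take K.*2 s; pose final := drop (L - K.*2) s.
pose mid := drop K.*2 (take (L - K.*2) s).
have sE : s = first ++ (mid ++ final).
  have fm : first ++ mid = take (L - K.*2) s.
    by rewrite -[RHS](cat_take_drop K.*2) take_takel.
  by rewrite catA fm cat_take_drop.
have szmid : size mid = (L - 4 * K)%N.
  by rewrite size_drop size_takel ?K3 // sL leq_subr.
pose B1 := [set x in map snd first] :&: X.
pose B2 := [set x in map snd final] :&: X.
have U2' := U2; rewrite sE !map_cat in U2'.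
have [Uf Ul] : uniq (map snd first) /\ uniq (map snd final).
  by move: U2'; rewrite cat_uniq => /and3P[-> _]; rewrite cat_uniq => /and3P[].
have half (s' : seq ('I_c * 'I_n)) : size s' = K.*2 -> uniq (map snd s') ->
    alternating X (map snd s') -> #|[set x in map snd s'] :&: X| = K.
  move=> sz Us' /count_alternating; rewrite size_map sz card_set_count //.
  by rewrite uphalf_double doubleK -eqn_leq eq_sym => /eqP.
have B1K : #|B1| = K.
  apply: half => //; first by rewrite size_takel // sL.
  by rewrite /alternating map_take take_sorted.
have B2K : #|B2| = K.
  apply: half => //; first by rewrite size_drop sL subKn.
  by rewrite /alternating map_drop drop_sorted.
have dB : [disjoint B1 & B2].
  rewrite -setI_eq0; apply/eqP/setP => x; rewrite !inE.
  apply: contraTF U2' => /and3P[/andP[xf _] xl _].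
  rewrite cat_uniq negb_and; apply/orP; right; rewrite negb_and negbK.
  by apply/orP; left; apply/hasP; exists x; rewrite // mem_cat xl orbT.
pose C := [set k | k \notin map fst s].
have hC : (c <= #|C| + L)%N.
  rewrite -sL -(size_map fst) -[X in (X <= _)%N]card_ord -(cardC (mem (map fst s))).
  rewrite addnC leq_add ?card_size // subset_leq_card //.
  by apply/fintype.subsetP => k; rewrite !inE.
rewrite -[(K ^ 2)%N]mulnn -{1}B1K -{1}B2K -card_pairs //.
apply: (condP_avoid c0 p01 (hq _ hC)).
  rewrite -setI_eq0; apply/eqP/setP => e; rewrite finset.in_set0; apply/setIP.
  case=> /pairsP[x [y [xB yB ve]]] /(fintype.subsetP QX)/pairsP[x' [y' [_ y'X ve']]].
  move: y'X; rewrite inE; have : y' \in [set x; y] by rewrite -ve ve' set22.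
  move: xB yB; rewrite !inE => /andP[_ xX] /andP[_ yX].
  by case/orP=> /eqP->; rewrite ?xX ?yX.
move=> g e k gh /pairsP[x0 [y0 [/setIP[+ _] /setIP[+ _] ve]]]; rewrite !inE.
move=> /mapP[x xf xE] /mapP[y yf yE] ks ge; rewrite {}xE {}yE in ve.
have [a1 [a2 Ea]] : exists a1 a2, first = a1 ++ x :: a2.
  by case/splitPr: xf => a1 a2; exists a1, a2.
have [b1 [b2 Eb]] : exists b1 b2, final = b1 ++ y :: b2.
  by case/splitPr: yf => b1 b2; exists b1, b2.
have E : s = a1 ++ (rcons (x :: a2 ++ mid ++ b1) y ++ b2).
  by rewrite sE Ea Eb cat_rcons -!catA /= -!catA.
have path_g : sorted (dart finset.setT g) s.
  apply: sub_sorted path_s; apply: dart_sub; first exact: finset.subsetT.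
  by move=> e' /gh.
rewrite E in path_g U1 U2 ks.
have [] // := close_cycle path_g U1 U2 _ ks ve ge.
  by rewrite !size_cat szmid; clear -KL; lia.
move=> /hA H /H; apply.
by rewrite size_map size_rcons /= !size_cat szmid; clear; lia.
Qed.

(** * The depth-first search *)

(** [s] is the current path, top first, and [T] the set of unvisited vertices; the
    finished vertices are the others.  The colour carried by the bottom vertex of
    [s] is arbitrary, and it is counted as used. *)
Record search_state (n c : nat) (X : {set 'I_n}) (Q : {set vpair n})
    (h : coloured_graph n c) (s : seq ('I_c * 'I_n)) (T : {set 'I_n}) : Prop :=
  SearchState {
    colours_uniq : uniq (map fst s);
    vertices_uniq : uniq (map snd s);
    search_path : sorted (dart Q h) s;
    path_visited : forall x, x \in map snd s -> x \notin T;
    path_alternating : alternating X (map snd s);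
    revealed_crossing : Q \subset pairs X (~: X);
    finished_revealed : forall x y e, x \notin T -> x \notin map snd s ->
      y \in T -> (x \in X) != (y \in X) -> val e = [set x; y]%SET -> e \in Q }.

(** The path takes at most half of its vertices, rounded up, from [X]; so neither
    half of the graph can be used up by the path and the unvisited vertices. *)
Lemma card_finished (n L t M : nat) (X T : {set 'I_n}) (s : seq 'I_n) :
  uniq s -> alternating X s -> (size s < L)%N -> (#|T| <= t)%N ->
  (n./2 <= #|X|)%N -> (M + t + L./2 <= n./2)%N ->
  (M <= #|X :\: (T :|: [set x in s])|)%N.
Proof.
move=> Us alt sL Tt Xn le.
have := cardsID (T :|: [set x in s]) X.
have : (#|X :&: (T :|: [set x in s])| <= #|T| + #|[set x in s] :&: X|)%N.
  rewrite finset.setIUr; apply: (leq_trans (leq_card_setU _ _)).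
  rewrite [X :&: [set x in s]]finset.setIC leq_add // subset_leq_card //.
  exact: finset.subsetIr.
rewrite card_set_count //.
have /andP[_] := count_alternating alt; rewrite uphalfE.
move: (half_leq sL) Tt Xn le; move: #|T| #|X| (count _ s) => a b d.
by move: #|_| #|_| (n./2) (L./2) ((size s).+1./2) => *; lia.
Qed.

(** With [M] finished vertices in either half, each of the [t] unvisited vertices
    is in a revealed pair with [M] finished ones of the opposite half. *)
Lemma card_revealed (n c L t M : nat) (X : {set 'I_n}) (Q : {set vpair n})
    (h : coloured_graph n c) (s : seq ('I_c * 'I_n)) (T : {set 'I_n}) :
  search_state X Q h s T -> (size s < L)%N -> #|T| = t ->
  (n./2 <= #|X|)%N -> (n./2 <= #|~: X|)%N -> (M + t + L./2 <= n./2)%N ->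
  (M * t <= #|Q|)%N.
Proof.
move=> st sL Tt Xn XCn le.
pose V := T :|: [set x in map snd s].
have szs : (size (map snd s) < L)%N by rewrite size_map.
have leT : (#|T| <= t)%N by rewrite Tt.
have M1 : (M <= #|X :\: V|)%N.
  exact: card_finished (vertices_uniq st) (path_alternating st) szs leT Xn le.
have M2 : (M <= #|(~: X) :\: V|)%N.
  apply: card_finished (vertices_uniq st) _ szs leT XCn le.
  exact/alternating_setC/(path_alternating st).
pose F1 := pairs (X :\: V) (T :\: X); pose F2 := pairs (T :&: X) ((~: X) :\: V).
have dX (B D : {set 'I_n}) : B \subset X -> D \subset ~: X -> [disjoint B & D].
  by move=> BX DX; rewrite (disjointWl BX) // (disjointWr DX) // -setI_eq0 finset.setICr.
have F1E : #|F1| = (#|X :\: V| * #|T :\: X|)%N.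
  apply/card_pairs/dX; first exact: finset.subsetDl.
  by apply/fintype.subsetP => x; rewrite !inE => /andP[].
have F2E : #|F2| = (#|T :&: X| * #|(~: X) :\: V|)%N.
  by apply/card_pairs/dX; [exact: finset.subsetIr | exact: finset.subsetDl].
have dF : [disjoint F1 & F2].
  rewrite -setI_eq0; apply/eqP/setP => e; rewrite finset.in_set0; apply/setIP.
  case=> /pairsP[x [y [xA yA ve]]] /pairsP[x' [y' [xA' yA' ve']]].
  have [xx _] : (x, y) = (x', y').
    move: xA yA xA' yA' ve; rewrite ve' !inE.
    move=> /andP[_ xX] /andP[yX _] /andP[_ xX'] /andP[_ yX'] /esym.
    by apply: (set2_eq_cross (dX _ _ (subxx X) (subxx (~: X)))); rewrite ?inE.
  by move: xA xA'; rewrite -xx !inE negb_or => /andP[/andP[/negbTE-> _] _].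
have FQ : F1 :|: F2 \subset Q.
  apply/fintype.subsetP => e /setUP[] /pairsP[x [y [xA yA ve]]];
    move: xA yA; rewrite !inE.
    rewrite negb_or -andbA => /and3P[xT xs xX] /andP[yX yT].
    by apply: (finished_revealed st xT xs yT _ ve); rewrite xX (negbTE yX).
  rewrite negb_or => /andP[xT xX] /andP[/andP[yT ys] yX].
  apply: (finished_revealed st yT ys xT); first by rewrite xX (negbTE yX).
  by rewrite ve finset.setUC.
apply: (leq_trans _ (subset_leq_card FQ)); rewrite cardsU.
move: dF; rewrite -setI_eq0 => /eqP->; rewrite cards0 subn0 F1E F2E.
rewrite -Tt -(cardsID X T) mulnDr addnC leq_add // ?leq_mul2r ?M1 ?orbT //.
by rewrite mulnC leq_mul2l M2 orbT.
Qed.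

Lemma search_restart (n c : nat) (X : {set 'I_n}) (Q : {set vpair n})
    (h : coloured_graph n c) (T : {set 'I_n}) (k : 'I_c) (x : 'I_n) :
  search_state X Q h [::] T -> x \in T ->
  search_state X Q h [:: (k, x)] (T :\ x).
Proof.
case=> _ _ _ _ _ QX fin xT; split=> //=.
- by move=> y; rewrite !inE => /eqP->; rewrite eqxx.
- move=> y z e; rewrite !inE negb_and negbK => /orP[->//|yT] _ /andP[_ zT].
  exact: fin.
Qed.

Lemma search_pop (n c : nat) (X : {set 'I_n}) (Q : {set vpair n})
    (h : coloured_graph n c) (T : {set 'I_n}) (v : 'I_c * 'I_n)
    (s : seq ('I_c * 'I_n)) :
  search_state X Q h (v :: s) T ->
  (forall u e, u \in T -> (v.2 \in X) != (u \in X) ->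
     val e = [set v.2; u]%SET -> e \in Q) ->
  search_state X Q h s T.
Proof.
case=> /= /andP[_ U1] /andP[_ U2] ps vis alt QX fin vQ; split=> //.
- exact: path_sorted ps.
- by move=> x xs; apply: vis; rewrite inE xs orbT.
- exact: path_sorted alt.
- move=> x y e xT xs yT xy ve; have [E|ne] := eqVneq x v.2.
    by apply: vQ yT _ _; rewrite -E.
  by apply: fin ve; rewrite // inE (negbTE ne).
Qed.

Lemma search_reveal (n c : nat) (X : {set 'I_n}) (Q : {set vpair n})
    (h : coloured_graph n c) (T : {set 'I_n}) (s : seq ('I_c * 'I_n))
    (e : vpair n) (o : option 'I_c) :
  search_state X Q h s T -> e \notin Q -> e \in pairs X (~: X) ->
  search_state X (e |: Q) (recolour h e o) s T.
Proof.
case=> U1 U2 ps vis alt QX fin eQ eX; split=> //.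
- apply: sub_sorted ps; apply: dart_sub; first exact: finset.subsetUr.
  by move=> e' e'Q; rewrite ffunE ifN //; apply: contraNneq eQ => <-.
- by rewrite finset.subUset finset.sub1set eX.
- by move=> x y e' xT xs yT xy ve; rewrite inE (fin x y) ?orbT.
Qed.

Lemma search_push (n c : nat) (X : {set 'I_n}) (Q : {set vpair n})
    (h : coloured_graph n c) (T : {set 'I_n}) (v : 'I_c * 'I_n)
    (s : seq ('I_c * 'I_n)) (u : 'I_n) (k : 'I_c) (e : vpair n) :
  search_state X Q h (v :: s) T -> u \in T -> (v.2 \in X) != (u \in X) ->
  k \notin map fst (v :: s) -> val e = [set v.2; u]%SET -> e \in Q ->
  h e = Some k ->
  search_state X Q h ((k, u) :: v :: s) (T :\ u).
Proof.
case=> U1 U2 ps vis alt QX fin uT vu ks ve eQ he; split=> //.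
- by rewrite map_cons cons_uniq ks.
- rewrite map_cons cons_uniq U2 andbT.
  by apply: contraL uT => /vis.
- rewrite /=; apply/andP; split=> //.
  by apply/dartP; exists e; rewrite ve finset.setUC.
- move=> x; rewrite map_cons in_cons in_setD1 => /orP[->//|/vis/negbTE->].
  by rewrite andbF.
- by rewrite /alternating /= eq_sym vu.
- move=> x y e'; rewrite !in_setD1 map_cons in_cons negb_or negb_and negbK.
  move=> /orP[->//|xT] /andP[_ xs] /andP[_ yT]; exact: fin.
Qed.

(** The factor [2 ^+ #|T| * (1 - q / 2) ^+ (M * t - #|Q|)] does not increase on
    average: a question shortens the exponent by one and halves the power of two
    with probability at least [q], and 1 - q + q/2 = 1 - q/2.  Once [M * t] pairs
    are revealed it is at least 1; this happens before [T] gets down to [t]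
    elements, by [card_revealed], so that a new vertex is always available.  The
    other term pays for closing the path when it reaches [L] vertices.  The
    induction is on a quantity that drops when a pair is revealed, a vertex is
    visited, or the path is popped. *)
Lemma condP_search (R : realType) (n c L K M t : nat) (p q : R)
    (X : {set 'I_n}) (A : pred (coloured_graph n c)) :
  (0 < c)%N -> 0 <= p <= 1 -> 0 <= q <= 1 ->
  (forall C : {set 'I_c}, (c <= #|C| + L)%N -> q <= p * #|C|%:R / c%:R) ->
  (4 * K < L)%N ->
  (forall g s, is_cycle g s -> rainbow g (cycle_edges s) ->
     (L - 4 * K + 2 <= size s)%N -> ~~ A g) ->
  (n./2 <= #|X|)%N -> (n./2 <= #|~: X|)%N -> (M + t + L./2 <= n./2)%N ->
  forall (Q : {set vpair n}) (h : coloured_graph n c) s (T : {set 'I_n}),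
  search_state X Q h s T -> (t <= #|T|)%N -> (size s <= L)%N ->
  condP p Q h A <=
  2 ^+ #|T| * (1 - q / 2) ^+ (M * t - #|Q|) + (1 - q) ^+ (K ^ 2).
Proof.
move=> c0 p01 /andP[q0 q1] hq KL hA Xn XCn le Q h s T.
have b0 : 0 <= 1 - q / 2 by lra.
have k0 : 0 <= (1 - q) ^+ (K ^ 2) by rewrite exprn_ge0 // subr_ge0.
have [m] := ubnP (#|T|.*2 + size s + #|~: Q|)%N.
elim: m Q h s T => // m IH Q h s T; rewrite ltnS => bound st tT sL.
have [sLe|sLt] := eqVneq (size s) L.
  have := condP_close c0 p01 hq KL hA sLe (colours_uniq st) (vertices_uniq st)
    (search_path st) (path_alternating st) (revealed_crossing st).
  by move/le_trans; apply; rewrite lerDr mulr_ge0 ?exprn_ge0.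
have {}sLt : (size s < L)%N by rewrite ltn_neqAle sLt.
have [QN|QN] := leqP (M * t) #|Q|.
  apply: (le_trans (condP_le1 _ _ _ c0 p01)).
  have -> : (M * t - #|Q| = 0)%N by apply/eqP; rewrite subn_eq0.
  by rewrite expr0 mulr1 -[X in X <= _]addr0 lerD // exprn_ege1 // ler1n.
have {}tT : (t < #|T|)%N.
  rewrite ltn_neqAle tT andbT; apply: contraTneq QN => tT'.
  by rewrite -leqNgt; apply: card_revealed st sLt (esym tT') Xn XCn le.
(* An empty path is restarted at any unvisited vertex, with a dummy colour. *)
case: s st sL sLt bound => [|v s] st sL sLt bound.
  have /card_gt0P[x xT] : (0 < #|T|)%N by apply: leq_ltn_trans tT.
  have cT := cardsD1 x T; rewrite xT add1n in cT.
  apply: (le_trans (IH _ _ _ _ _ (search_restart (Ordinal c0) st xT) _ _)).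
  - by apply: leq_trans bound; rewrite cT doubleS /= addn0 addn1 !addSn.
  - by move: tT; rewrite cT ltnS.
  - by apply: leq_trans KL.
  rewrite lerD2r ler_wpM2r ?exprn_ge0 // cT exprS ler_peMl ?exprn_ge0 //.
  by rewrite ler1n.
(* Either the top vertex has a fresh pair to an unvisited vertex, or it is
   popped. *)
have [unseen|seen] := pselect (exists u e, [/\ u \in T,
    (v.2 \in X) != (u \in X), val e = [set v.2; u]%SET & e \notin Q]); last first.
  apply: (IH _ _ s) => //; last exact: ltnW (ltnW sLt).
  - by move: bound => /=; rewrite addnS addSn.
  - apply: search_pop st _ => u e uT vu ve.
    by apply: contrapT => /negP eQ; apply: seen; exists u, e.
  - exact: ltnW.
have [u [e [uT vu ve eQ]]] := unseen.
have cT := cardsD1 u T; rewrite uT add1n in cT.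
have cQ : #|e |: Q| = #|Q|.+1 by rewrite cardsU1 eQ.
have cQC : (#|~: (e |: Q)| < #|~: Q|)%N.
  apply: proper_card; rewrite properC fintype.properE finset.subsetUr /=.
  by apply/subsetPn; exists e; rewrite ?setU11.
have eX : e \in pairs X (~: X).
  apply/pairsP; move: vu.
  case: (boolP (v.2 \in X)) => vX; case: (boolP (u \in X)) => uX // _.
    by exists v.2, u; rewrite inE.
  by exists u, v.2; rewrite inE finset.setUC.
pose C := [set k | k \notin map fst (v :: s)].
have hC : (c <= #|C| + L)%N.
  have sL' : (size (map fst (v :: s)) <= L)%N by rewrite size_map.
  rewrite -[X in (X <= _)%N]card_ord -(cardC (mem (map fst (v :: s)))).
  rewrite addnC leq_add ?(leq_trans (card_size _)) // subset_leq_card //.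
  by apply/fintype.subsetP => k; rewrite !inE.
have -> : (M * t - #|Q| = (M * t - #|Q|.+1).+1)%N by rewrite subnSK.
set b := 1 - q / 2; set N := (M * t - #|Q|.+1)%N; set kap := (1 - q) ^+ (K ^ 2).
rewrite (condP_step p h A c0 eQ).
apply: (le_trans (@colour_law_mean_le _ _ p q C _ (2 ^+ #|T| * b ^+ N + kap)
  (2 ^+ #|T :\ u| * b ^+ N + kap) c0 p01 (hq _ hC) _ _ _)); last first.
- rewrite cT [b ^+ _.+1]exprS [2 ^+ _.+1]exprS.
  move: (2 ^+ _) (b ^+ N) (kap) => x y z.
  by rewrite /b le_eqVlt; apply/orP; left; apply/eqP; clear; field.
- move=> k; rewrite inE => ks; rewrite /N -cQ.
  have st' := search_reveal (Some k) st eQ eX.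
  apply: IH (search_push st' uT vu ks ve _ _) _ _ => //.
  + apply: leq_trans bound; rewrite cT doubleS /= !addSn !addnS !ltnS.
    by rewrite leq_add2l ltnW.
  + by rewrite setU11.
  + by rewrite ffunE eqxx.
  + by move: tT; rewrite cT ltnS.
- move=> o; rewrite /N -cQ; apply: IH (search_reveal o st eQ eX) (ltnW tT) sL.
  by apply: leq_trans bound; rewrite ltn_add2l.
- rewrite lerD2r ler_wpM2r ?exprn_ge0 // cT exprS ler_peMl ?exprn_ge0 //.
  by rewrite ler1n.
Qed.

(** * Probability estimates *)

Lemma exists_half_set (n : nat) :
  exists X : {set 'I_n}, (n./2 <= #|X|)%N /\ (n./2 <= #|~: X|)%N.
Proof.
exists [set x in take n./2 (enum 'I_n)].
have cX : #|[set x in take n./2 (enum 'I_n)]| = n./2.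
  rewrite cardsE; have /card_uniqP-> := take_uniq n./2 (enum_uniq 'I_n).
  by rewrite size_takel // size_enum_ord; lia.
have := cardsC [set x in take n./2 (enum 'I_n)]; rewrite cX card_ord => E.
by split=> //; move: E; clear; move: #|~: _| => k; lia.
Qed.

Lemma Gcnp_prob_le (R : realType) (n c : nat) (p : R)
    (A B : set (coloured_graph n c)) :
  0 <= p <= 1 -> (forall g, A g -> B g) -> Gcnp_prob p A <= Gcnp_prob p B.
Proof.
move=> p01 AB; rewrite /Gcnp_prob [leLHS]big_mkcond [leRHS]big_mkcond /=.
apply: ler_sum => g _; case: (boolP (g \in A)) => [gA|_].
  by rewrite (mem_set (AB g (set_mem gA))).
by case: ifP => // _; apply: Gcnp_ge0.
Qed.

Lemma Gcnp_prob_le1 (R : realType) (n c : nat) (p : R)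
    (A : set (coloured_graph n c)) :
  (0 < c)%N -> 0 <= p <= 1 -> Gcnp_prob p A <= 1.
Proof.
move=> c0 p01; rewrite -(Gcnp_sum1 n p c0) /Gcnp_prob [leLHS]big_mkcond /=.
by apply: ler_sum => g _; case: ifP => // _; apply: Gcnp_ge0.
Qed.

(** The search started with nothing revealed and an empty path. *)
Lemma Gcnp_prob_rainbow_cycle (R : realType) (n c L K M t : nat) (p q l : R) :
  (0 < c)%N -> 0 <= p <= 1 -> 0 <= q <= 1 ->
  (forall C : {set 'I_c}, (c <= #|C| + L)%N -> q <= p * #|C|%:R / c%:R) ->
  (4 * K < L)%N -> l <= (L - 4 * K + 2)%:R -> (M + t + L./2 <= n./2)%N ->
  1 - (2 ^+ n * (1 - q / 2) ^+ (M * t) + (1 - q) ^+ (K ^ 2)) <=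
  Gcnp_prob p [set g : coloured_graph n c | has_rainbow_cycle_of_length_ge g l].
Proof.
move=> c0 p01 q01 hq KL lL le; set A := [set g | _]%classic.
have [X [Xn XCn]] := exists_half_set n.
pose bad : pred (coloured_graph n c) := fun g => g \notin A.
have hA (g : coloured_graph n c) (s : seq 'I_n) : is_cycle g s ->
    rainbow g (cycle_edges s) -> (L - 4 * K + 2 <= size s)%N -> ~~ bad g.
  move=> Cs Rs sz; rewrite negbK inE; exists s; split=> //.
  by rewrite (le_trans lL) // ler_nat.
have st : search_state X finset.set0 [ffun=> None] ([::] : seq ('I_c * 'I_n))
    finset.setT.
  by split=> //; [exact: finset.sub0set | move=> x y e; rewrite inE].
have := condP_search c0 p01 q01 hq KL hA Xn XCn le st _ (leq0n L).
rewrite cards0 subn0 cardsT card_ord => /(_ _)/[dup] H _.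
rewrite lerBlDr -lerBlDl; apply: le_trans (H _); last first.
  by move: le; clear; lia.
rewrite -(Gcnp_sum1 n p c0) (bigID (fun g => g \in A)) /= addrC /Gcnp_prob addrK.
rewrite big_mkcond; apply: ler_sum => g _.
have -> : override finset.set0 [ffun=> None] g = g.
  by apply/ffunP => e; rewrite ffunE inE.
by rewrite /bad; case: ifP => _; rewrite ?mulr1 // mulr0.
Qed.

Lemma expn1B_le_expR (R : realType) (x : R) (k : nat) :
  x <= 1 -> (1 - x) ^+ k <= expR (- (k%:R * x)).
Proof.
move=> x1; rewrite -mulrN expRM_natl lerXn2r ?nnegrE ?subr_ge0 ?expR_ge0 //.
exact: expR_ge1Dx.
Qed.

Lemma expRN_le_inv (R : realType) (x y : R) : 0 < x -> x <= y -> expR (- y) <= x^-1.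
Proof.
move=> x0 xy; rewrite expRN lef_pV2 ?posrE ?expR_gt0 //.
by rewrite (le_trans xy) // (le_trans _ (expR_ge1Dx y)) // lerDr.
Qed.

Lemma nat_floor (R : realType) (x : R) :
  0 <= x -> exists k : nat, k%:R <= x < k%:R + 1.
Proof.
by move=> x0; exists (Num.truncn x); rewrite natr1 truncn_itv.
Qed.

(** The path gets L = (1 - delta/2) m vertices and K = delta m/8, so that the
    cycle misses at most a further delta m/2; and with t = delta n/16 unvisited
    vertices, at least as many in each half are finished. *)
Lemma search_parameters (R : realType) (delta : R) (n m : nat) :
  0 < delta <= 2^-1 -> (m <= n)%N -> 64 <= delta * n%:R ->
  16 <= delta * m%:R ->
  exists t K L : nat,
    [/\ delta * n%:R / 32 <= t%:R, delta * m%:R / 16 <= K%:R,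
        L%:R <= (1 - delta / 2) * m%:R, (4 * K < L)%N &
        (t + t + L./2 <= n./2)%N /\
        (1 - delta) * m%:R <= (L - 4 * K + 2)%:R].
Proof.
move=> /andP[delta0 delta1] mn dn dm.
have zm : delta * m%:R <= m%:R / 2 :> R by rewrite mulrC ler_wpM2l.
have Lmn : m%:R - delta * m%:R / 2 <= n%:R - delta * n%:R / 2 :> R.
  have -> : m%:R - delta * m%:R / 2 = (1 - delta / 2) * m%:R :> R by ring.
  have -> : n%:R - delta * n%:R / 2 = (1 - delta / 2) * n%:R :> R by ring.
  by rewrite ler_wpM2l ?ler_nat // subr_ge0; clear -delta1; lra.
rewrite [(1 - delta / 2) * _]mulrBl [(1 - delta) * _]mulrBl mul1r.
rewrite [delta / 2 * _]mulrAC.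
move: zm Lmn dn dm; set x := delta * n%:R; set z := delta * m%:R.
move: x z (m%:R) => x z y {delta delta0 delta1 mn} zm Lmn dn dm.
have [t /andP[t1 t2]] := @nat_floor R (x / 16) ltac:(lra).
have [K /andP[K1 K2]] := @nat_floor R (z / 8) ltac:(lra).
have [L /andP[L1 L2]] := @nat_floor R (y - z / 2) ltac:(lra).
have KL : (4 * K < L)%N by rewrite -(ltr_nat R) natrM; lra.
exists t, K, L; split=> //; [lra | lra | split].
  suff : (4 * t + L + 2 <= n)%N by clear; lia.
  by rewrite -(ler_nat R) natrD (natrD _ (4 * t)%N) natrM; lra.
by rewrite natrD (natrB _ (ltnW KL)) natrM; lra.
Qed.

(** Since q t^2/2 is at least d delta^3 n/4096 = 2n, the [n] possible successes,
    which cost a factor [2 ^+ n <= expR n], are outweighed. *)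
Lemma search_failure_le (R : realType) (delta d q : R) (n t : nat) :
  0 < delta -> d * delta ^+ 3 = 2 ^+ 13 -> (0 < n)%N ->
  q = d / n%:R * delta / 2 -> 0 <= q <= 1 -> delta * n%:R / 32 <= t%:R ->
  2 ^+ n * (1 - q / 2) ^+ (t * t) <= n%:R^-1.
Proof.
move=> delta0 dE n0 qE /andP[q0 q1] ht.
have nR : 0 < n%:R :> R by rewrite ltr0n.
have q2 : q / 2 <= 1 by rewrite ler_pdivrMr // mul1r (le_trans q1) // ler1n.
have e1 : (1 - q / 2) ^+ (t * t) <= expR (- (2 * n%:R)).
  apply: (le_trans (expn1B_le_expR (t * t) q2)).
  rewrite ler_expR lerN2 natrM.
  have x0 : 0 <= delta * n%:R / 32 by rewrite divr_ge0 // mulr_ge0 // ltW.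
  have -> : 2 * n%:R = delta * n%:R / 32 * (delta * n%:R / 32) * (q / 2).
    transitivity (d * delta ^+ 3 * n%:R / 4096); first by rewrite dE; field.
    by rewrite qE; field; rewrite gt_eqF.
  by rewrite ler_wpM2r ?divr_ge0 // ler_pM.
have e2 : (2 : R) ^+ n <= expR n%:R.
  rewrite -[n%:R]mulr1 expRM_natl lerXn2r ?nnegrE ?expR_ge0 //.
  exact: expR_ge1Dx.
apply: (le_trans (ler_pM _ _ e2 e1)); rewrite ?exprn_ge0 ?subr_ge0 //.
rewrite -expRD mulrDl mul1r opprD addrA subrr add0r.
exact: expRN_le_inv.
Qed.

Lemma closing_failure_le (R : realType) (delta d q gamma : R) (n m K : nat) :
  0 < delta -> d * delta ^+ 3 = 2 ^+ 13 -> (0 < n)%N ->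
  q = d / n%:R * delta / 2 -> 0 <= q <= 1 -> 0 < gamma ->
  gamma * n%:R <= m%:R -> delta * m%:R / 16 <= K%:R ->
  (1 - q) ^+ (K ^ 2) <= (16 * gamma ^+ 2)^-1 / n%:R.
Proof.
move=> delta0 dE n0 qE /andP[q0 q1] gamma0 gm hK.
have nR : 0 < n%:R :> R by rewrite ltr0n.
apply: (le_trans (expn1B_le_expR (K ^ 2) q1)).
rewrite -invfM; apply: expRN_le_inv; first by rewrite !mulr_gt0 // exprn_gt0.
have -> : 16 * gamma ^+ 2 * n%:R = (delta * (gamma * n%:R) / 16) ^+ 2 * q.
  transitivity (d * delta ^+ 3 * gamma ^+ 2 * n%:R / 512).
    by rewrite dE; field.
  by rewrite qE; field; rewrite gt_eqF.
rewrite natrX ler_wpM2r // lerXn2r ?nnegrE //.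
  by rewrite divr_ge0 // !mulr_ge0 // ltW.
by apply: le_trans hK; rewrite ler_pM2r // ler_pM2l.
Qed.

(** The error is uniform over all [c] and [m]; how [c] compares to [n] only enters
    through [gamma]. *)
Lemma Gcnp_prob_long_cycle (R : realType) (delta d gamma : R) (n c m : nat) :
  0 < delta <= 2^-1 -> d * delta ^+ 3 = 2 ^+ 13 -> 0 < gamma -> (0 < n)%N ->
  (m <= n)%N -> (m <= c)%N -> gamma * n%:R <= m%:R -> 64 <= delta * n%:R ->
  16 <= delta * m%:R -> d <= n%:R ->
  1 - (1 + (16 * gamma ^+ 2)^-1) / n%:R <=
  Gcnp_prob (d / n%:R) [set g : coloured_graph n c |
    has_rainbow_cycle_of_length_ge g ((1 - delta) * m%:R)].
Proof.
move=> delta01 dE gamma0 n0 mn mc gm dn dm d_n.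
have [t [K [L [ht hK hL KL [tL lL]]]]] := search_parameters delta01 mn dn dm.
have /andP[delta0 delta1] := delta01.
have nR : 0 < n%:R :> R by rewrite ltr0n.
have c0 : (0 < c)%N.
  apply: leq_trans mc; rewrite -(ltr0n R) -(pmulr_rgt0 _ delta0).
  exact: lt_le_trans dm.
have d0 : 0 < d by rewrite -(pmulr_lgt0 _ (exprn_gt0 3 delta0)) dE exprn_gt0.
have p01 : 0 <= d / n%:R <= 1.
  by rewrite (divr_ge0 (ltW d0) (ltW nR)) ler_pdivrMr // mul1r.
have d2 : 0 <= delta / 2 <= 1.
  by rewrite (divr_ge0 (ltW delta0) (ler0n _ 2)); move: delta1; clear; lra.
have [q qE] : exists q, q = d / n%:R * delta / 2 by eexists.
have q01 : 0 <= q <= 1.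
  case/andP: p01 d2 => p0 p1 /andP[z0 z1].
  by rewrite qE -mulrA mulr_ge0 //= mulr_ile1.
have hq (C : {set 'I_c}) :
    (c <= #|C| + L)%N -> q <= d / n%:R * #|C|%:R / c%:R.
  rewrite -(ler_nat R) natrD => cC.
  case/andP: p01 d2 => p0 p1 /andP[z0 z1].
  rewrite qE -!(mulrA (d / n%:R)) ler_wpM2l // ler_pdivlMr ?ltr0n //.
  have h : (1 - delta / 2) * m%:R <= (1 - delta / 2) * c%:R.
    by rewrite ler_wpM2l ?subr_ge0 // ler_nat.
  move: (le_trans hL h) cC; rewrite mulrBl mul1r.
  by move: (delta / 2 * c%:R) => y; clear; lra.
have := Gcnp_prob_rainbow_cycle c0 p01 q01 hq KL lL tL.
apply: le_trans; rewrite lerB // mulrDl mul1r lerD //.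
  exact: search_failure_le dE n0 qE q01 ht.
exact: closing_failure_le dE n0 qE q01 gamma0 gm hK.
Qed.

(** * Long rainbow cycles *)

Local Open Scope classical_set_scope.
Local Open Scope ring_scope.

Theorem theorem1p5 (R : realType) (delta : R) (hdelta : 0 < delta) :
  exists2 d : R, 0 < d &
    forall (alpha : R) (halpha : 0 < alpha)
      (c : nat -> nat) (hc : forall n, `|(c n)%:R - alpha * n%:R| < 1),
    Gcnp_prob (d / n%:R)
      [set g : coloured_graph n (c n) |
        has_rainbow_cycle_of_length_ge g ((1 - delta) * (minn n (c n))%:R)]
      @[n --> \oo] --> (1 : R).
Proof.
(* A smaller deviation is a stronger claim, and [eta <= 1/2] leaves a path long
   enough for the vertices that are lost in closing it. *)
pose eta := Num.min delta 2^-1.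
have eta0 : 0 < eta by rewrite lt_min hdelta invr_gt0 ltr0n.
have eta1 : eta <= 2^-1 by rewrite ge_min lexx orbT.
have etad : eta <= delta by rewrite ge_min lexx.
exists (2 ^+ 13 / eta ^+ 3); first by rewrite divr_gt0 ?exprn_gt0.
set d := 2 ^+ 13 / _ => alpha alpha0 c hc.
have dE : d * eta ^+ 3 = 2 ^+ 13 by rewrite divfK // gt_eqF // exprn_gt0.
have d0 : 0 < d by rewrite divr_gt0 ?exprn_gt0.
(* Rounding [alpha * n] to [c n] costs less than 1, hence the factor 1/2. *)
pose gamma := Num.min 1 (alpha / 2).
have gamma0 : 0 < gamma by rewrite lt_min ltr01 divr_gt0.
pose D := 1 + (16 * gamma ^+ 2)^-1.
have D0 : 0 < D by rewrite addr_gt0 // invr_gt0 mulr_gt0 // exprn_gt0.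
apply/cvgrPdist_le => eps eps0; near=> n.
have n1 : 1 <= n%:R :> R by near: n; exact: nbhs_infty_ger.
have n0 : (0 < n)%N by rewrite -(ltr0n R) (lt_le_trans _ n1).
have nR : 0 < n%:R :> R by rewrite ltr0n.
have dn : d <= n%:R by near: n; exact: nbhs_infty_ger.
have n64 : 64 <= eta * n%:R.
  by rewrite mulrC -ler_pdivrMr //; near: n; exact: nbhs_infty_ger.
have n16 : 16 <= eta * (gamma * n%:R).
  rewrite mulrA [X in _ <= X]mulrC -ler_pdivrMr ?mulr_gt0 //.
  by near: n; exact: nbhs_infty_ger.
have na : 2 <= alpha * n%:R.
  by rewrite mulrC -ler_pdivrMr //; near: n; exact: nbhs_infty_ger.
have ne : D <= eps * n%:R.
  by rewrite mulrC -ler_pdivrMr //; near: n; exact: nbhs_infty_ger.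
have gm : gamma * n%:R <= (minn n (c n))%:R.
  have : alpha * n%:R - (c n)%:R < 1.
    by rewrite (le_lt_trans _ (hc n)) // distrC ler_norm.
  have g1 : gamma * n%:R <= n%:R by rewrite ler_piMl // ge_min lexx.
  have g2 : gamma * n%:R <= alpha / 2 * n%:R.
    by rewrite ler_wpM2r // ge_min lexx orbT.
  by rewrite /minn; case: ifP => _ cn; lra.
have c0 : (0 < c n)%N.
  rewrite lt0n; apply: contraTneq gm => ->.
  by rewrite minn0 -ltNge mulr_gt0.
have p01 : 0 <= d / n%:R <= 1.
  by rewrite (divr_ge0 (ltW d0) (ltW nR)) ler_pdivrMr // mul1r.
have P1 := Gcnp_prob_le1 (n := n) (c := c n) _ c0 p01.
rewrite ger0_norm ?subr_ge0 //.
have m16 : 16 <= eta * (minn n (c n))%:R.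
  by rewrite (le_trans n16) // ler_pM2l.
have etab : 0 < eta <= 2^-1 by rewrite eta0.
have := Gcnp_prob_long_cycle etab dE gamma0 n0 (geq_minl _ _) (geq_minr _ _)
  gm n64 m16 dn.
rewrite lerBlDr -lerBlDl => H.
have le_eps : D / n%:R <= eps by rewrite ler_pdivrMr.
apply: le_trans le_eps; apply: le_trans H; rewrite lerB //.
apply: Gcnp_prob_le => // g [s [Cs Rs ls]]; exists s; split=> //.
by apply: le_trans ls; rewrite ler_wpM2r // lerB.
Unshelve. all: by end_near. Qed.
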